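(* Let $s\in\mathbb{N}$ and $p,q\in[1,\infty]$, and assume $\alpha\ge 1/p$ if $q=1$ and $\alpha>1/p$ if $q>1$. Let $m\ge 1$, let $P$ be a $(t,m,s)$-net in base $b$, and put $N:=|P|=b^m$. Then there exists a constant $C$, independent of $N$, such that $$e^{\mathrm{wor}}(Q_P,\mathcal{H}_{\mathrm{wav},\alpha,s,p,q})\le C\,N^{-\alpha}\ln(N)^{\frac{s-1}{q'}},$$ where $1/q+1/q'=1$. In particular, for $q=1$, $$e^{\mathrm{wor}}(Q_P,\mathcal{H}_{\mathrm{wav},\alpha,s,p,1})\le C\,N^{-\alpha}.$$
   Context: Conventions: $1/\infty=0$ and $r^{1/\infty}=1$ for all real $r$; $p'$, $q'$ denote conjugate exponents. Fix an integer base $b\ge2$. Put $\Delta_{-1}=\{0\}$, $\Delta_j=\{0,1,\dots,b^j-1\}$ for $j\in\mathbb{N}_0$, $\nabla_0=\{0\}$ and $\nabla_j=\{0,1,\dots,b-1\}$ for $j\ge1$. Univariate Haar functions on $[0,1]$: $\psi^0_{0,0}=1_{[0,1)}$ and, for $j\ge1$, $i\in\nabla_j$, $k\in\Delta_{j-1}$, $\psi^j_{i,k}(x)=b^{j/2-1}\big(b\,1_{[b^{-j}(bk+i),\,b^{-j}(bk+i+1))}(x)-1_{[b^{1-j}k,\,b^{1-j}(k+1))}(x)\big)$. For $\mathbf{j}\in\mathbb{N}_0^s$ let $|\mathbf{j}|=j_1+\dots+j_s$, $\nabla_{\mathbf{j}}=\nabla_{j_1}\times\dots\times\nabla_{j_s}$,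 $\Delta_{\mathbf{j}-\mathbf{1}}=\Delta_{j_1-1}\times\dots\times\Delta_{j_s-1}$, and $\Psi^{\mathbf{j}}_{\mathbf{i},\mathbf{k}}(\mathbf{x})=\prod_{\ell=1}^s\psi^{j_\ell}_{i_\ell,k_\ell}(x_\ell)$. Write $\langle f,g\rangle=\int_{[0,1]^s}fg$. Haar wavelet space: for $p\in[1,\infty]$, $\alpha\in\mathbb{R}$, $q\in[1,\infty)$, and $f\in L_1([0,1]^s)$ put $\|f\|^q_{\mathrm{wav},\alpha,s,p,q}=\sum_{L=0}^\infty b^{q(\alpha-1/p+1/2)L}\sum_{|\mathbf{j}|=L}\Big(\sum_{\mathbf{k}\in\Delta_{\mathbf{j}-\mathbf{1}}}\sum_{\mathbf{i}\in\nabla_{\mathbf{j}}}|\langle f,\Psi^{\mathbf{j}}_{\mathbf{i},\mathbf{k}}\rangle|^p\Big)^{q/p}$ (with the inner $\ell_p$-sum replaced by a maximum if $p=\infty$), and $\mathcal{H}_{\mathrm{wav},\alpha,s,p,q}=\{f\in L_1([0,1]^s):\|f\|_{\mathrm{wav},\alpha,s,p,q}<\infty\}$. For $q=\infty$, $\|f\|_{\mathrm{wav},\alpha,s,p,\infty}=\sup_{\mathbf{j}\in\mathbb{N}_0^s}b^{(\alpha-1/p+1/2)|\mathbf{j}|}\big(\sum_{\mathbf{k}}\sum_{\mathbf{i}}|\langle f,\Psi^{\mathbf{j}}_{\mathbf{i},\mathbf{k}}\rangle|^p\big)^{1/p}$, and $\mathcal{H}_{\mathrm{wav},\alpha,s,p,\infty}$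 consists of those $f\in L_1$ with finite norm whose wavelet series $\mathcal{S}(f)=\sum_{\mathbf{j}}\sum_{\mathbf{k}}\sum_{\mathbf{i}}\langle f,\Psi^{\mathbf{j}}_{\mathbf{i},\mathbf{k}}\rangle\Psi^{\mathbf{j}}_{\mathbf{i},\mathbf{k}}$ converges pointwise and equals $f$ a.e. Under the stated conditions on $\alpha$, for every $f$ in the space the series $\mathcal{S}(f)(\mathbf{x})$ converges absolutely at every $\mathbf{x}\in[0,1]^s$ and equals $f$ a.e.; each $f$ is identified with $\mathcal{S}(f)$, so point evaluation is well defined. Nets: for $t,m\in\mathbb{N}_0$, a finite point set $P\subset[0,1)^s$ is a $(t,m,s)$-net in base $b$ if every elementary interval $\prod_{\ell=1}^s[a_\ell b^{-d_\ell},(a_\ell+1)b^{-d_\ell})$ with $d_\ell\in\mathbb{N}_0$, $0\le a_\ell<b^{d_\ell}$, of volume $b^{t-m}$ contains exactly $b^t$ points of $P$; then $|P|=b^m$. The QMC cubature is $Q_P(f)=b^{-m}\sum_{\mathbf{p}\in P}f(\mathbf{p})$. For a normed function space $X$, $e^{\mathrm{wor}}(Q,X)=\sup\{|\int_{[0,1]^s}f(\mathbf{x})\,d\mathbf{x}-Q(f)|: f\in X,\ \|f\|_X\le1\}$. *)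

(* Defs.v *)
From HB Require Import structures.
From mathcomp Require Import all_boot all_order all_algebra.
From mathcomp Require Import all_classical all_reals all_analysis.
Set Implicit Arguments. Unset Strict Implicit. Unset Printing Implicit Defensive.
Import Order.TTheory GRing.Theory Num.Theory.
Import numFieldNormedType.Exports.
Local Open Scope classical_set_scope.
Local Open Scope ring_scope.

Section HaarDefs.
Context {R : realType}.

(* 1/p with the convention 1/oo = 0 (p is an extended real in [1, oo]). *)
Definition recip (p : \bar R) : R := if p is r%:E then r^-1 else 0.

Definition haar1 (b j i k : nat) (x : R) : R :=
  if j == 0%N then ((0 <= x) && (x < 1))%:R
  else powR (b%:R) (j%:R / 2 - 1) *
    (b%:R * ((b%:R ^- j * (b * k + i)%:R <= x)
              && (x < b%:R ^- j * (b * k + i + 1)%:R))%:R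
     - ((b%:R ^- j.-1 * k%:R <= x) && (x < b%:R ^- j.-1 * k.+1%:R))%:R).

Definition haar {s : nat} (b : nat) (j i k : 'I_s -> nat) (x : s.-tuple R) : R :=
  \prod_(l < s) haar1 b (j l) (i l) (k l) (tnth x l).

Definition cube (s : nat) : set (s.-tuple R) :=
  [set x | forall l : 'I_s, 0 <= tnth x l <= 1].
Arguments cube : clear implicits.

Variables (s : nat) (lam : {measure set (s.-tuple R) -> \bar R}) (b : nat).

Definition coef (f : s.-tuple R -> R) (j i k : 'I_s -> nat) : R :=
  \int[lam]_(x in cube s) (f x * haar b j i k x).

(* inner l_p quantity over k in Delta_{j-1}, i in nabla_j;
   k_l < b^(j_l - 1) (truncated subtraction gives Delta_{-1} = {0}),
   i_l < b if j_l >= 1 and i_l = 0 if j_l = 0 *)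
Definition lpnorm (p : \bar R) (f : s.-tuple R -> R) (j : 'I_s -> nat) : R :=
  match p with
  | r%:E => powR (\sum_(k : {dffun forall l : 'I_s, 'I_(b ^ (j l - 1))})
                   \sum_(i : {dffun forall l : 'I_s, 'I_(if j l == 0%N then 1%N else b)})
                     powR `|coef f j (fun l => i l : nat) (fun l => k l : nat)| r) r^-1
  | _ => \big[Num.max/0]_(k : {dffun forall l : 'I_s, 'I_(b ^ (j l - 1))})
           \big[Num.max/0]_(i : {dffun forall l : 'I_s, 'I_(if j l == 0%N then 1%N else b)})
             `|coef f j (fun l => i l : nat) (fun l => k l : nat)|
  end.

Definition levelsum (L : nat) (F : ('I_s -> nat) -> R) : R :=
  \sum_(j : {ffun 'I_s -> 'I_L.+1} | (\sum_(l < s) (j l : nat) == L)%N)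
     F (fun l => j l : nat).

Definition wavnorm (alpha : R) (p q : \bar R) (f : s.-tuple R -> R) : \bar R :=
  let ex := alpha - recip p + 2^-1 in
  match q with
  | r%:E => poweR (\sum_(L <oo)
                     ((powR b%:R (r * ex * L%:R)
                       * levelsum L (fun j => powR (lpnorm p f j) r))%:E))%E r^-1
  | _ => ereal_sup (range (fun j : 'I_s -> nat =>
           (powR b%:R (ex * (\sum_(l < s) j l)%N%:R) * lpnorm p f j)%:E))
  end.

Definition wavlevel (f : s.-tuple R -> R) (L : nat) (x : s.-tuple R) : R :=
  levelsum L (fun j =>
    \sum_(k : {dffun forall l : 'I_s, 'I_(b ^ (j l - 1))})
     \sum_(i : {dffun forall l : 'I_s, 'I_(if j l == 0%N then 1%N else b)})
       coef f j (fun l => i l : nat) (fun l => k l : nat)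
       * haar b j (fun l => i l : nat) (fun l => k l : nat) x).

Definition wavseries (f : s.-tuple R -> R) (x : s.-tuple R) : R :=
  limn (series (fun L => wavlevel f L x)).

Definition in_Hwav (alpha : R) (p q : \bar R) (f : s.-tuple R -> R) : Prop :=
  [/\ lam.-integrable (cube s) (EFin \o f),
      (wavnorm alpha p q f < +oo)%E &
      (q = +oo%E ->
        (forall x, cube s x -> cvgn (series (fun L => wavlevel f L x))) /\
        {ae lam, forall x, cube s x -> wavseries f x = f x})].

Definition is_net (t m : nat) (P : seq (s.-tuple R)) : Prop :=
  [/\ uniq P, (t <= m)%N,
      (forall x, x \in P -> forall l : 'I_s, 0 <= tnth x l < 1) &
      (forall d a : 'I_s -> nat, (forall l, a l < b ^ d l)%N ->
         (\sum_(l < s) d l)%N = (m - t)%N ->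
         count (fun x => [forall l : 'I_s,
                   ((a l)%:R * b%:R ^- d l <= tnth x l)
                   && (tnth x l < (a l).+1%:R * b%:R ^- d l)]) P = (b ^ t)%N)].

(* QMC rule Q_P(f) = b^-m sum_{x in P} f(x), with f identified with S(f) *)
Definition QMC (m : nat) (P : seq (s.-tuple R)) (f : s.-tuple R -> R) : R :=
  b%:R ^- m * \sum_(x <- P) wavseries f x.

Definition wce (alpha : R) (p q : \bar R) (m : nat) (P : seq (s.-tuple R)) : \bar R :=
  ereal_sup [set (`| \int[lam]_(x in cube s) f x - QMC m P f |)%:E
             | f in [set f | in_Hwav alpha p q f /\ (wavnorm alpha p q f <= 1)%E]].

End HaarDefs.

(* Main.v *)
(* On level 0 the rule returns the integral of f, because the Haar coefficient of
   order 0 is that integral and the net has b^m points. A Haar function of level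
   0 < |j| <= m - t is a combination of indicators of elementary intervals of order
   j, each hit equally often by the net, so its sum over the net vanishes. For
   |j| > m - t, every support contains at most b^(t+s) net points and at most
   b^(m+s) pairs (k, i) see the net; Hoelder's inequality over those pairs bounds
   the contribution of j by a constant times b^(-m/p) b^(|j|/2) times the l_p norm
   of the coefficients. Hoelder over the at most (L+1)^(s-1) indices of level L
   and a geometric tail sum over L > m - t give the rate. *)
Require Import Defs.
From HB Require Import structures.
From mathcomp Require Import all_boot all_order all_algebra.
From mathcomp Require Import all_classical all_reals all_analysis.
From mathcomp Require Import ring lra zify.
Set Implicit Arguments. Unset Strict Implicit. Unset Printing Implicit Defensive.
Import Order.TTheory GRing.Theory Num.Theory.
Import numFieldNormedType.Exports.
Local Open Scope classical_set_scope.
Local Open Scope ring_scope.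

(** * Hölder's inequality for finite sums, and a convergent tail sum *)

Section FiniteSums.
Context {R : realType}.

(** Hölder against the constant function 1, with [n] any upper bound for the number of terms. It
    follows by applying Young's inequality to each term, normalised by the l_r norm [M]. *)
Lemma sum_le_card_powR (I : finType) (A : pred I) (x : I -> R) (r n : R) :
  1 <= r -> (forall i, 0 <= x i) -> #|A|%:R <= n ->
  \sum_(i | A i) x i
    <= powR n (1 - r^-1) * powR (\sum_(i | A i) powR (x i) r) r^-1.
Proof.
move=> r1 x0 An.
have r0 : 0 < r by lra.
(* For r = 1 the conjugate exponent is infinite, and [(1 - r^-1)^-1] would collapse to 0, so this
   case is treated apart. *)
have [->|rn1] := eqVneq r 1.
  rewrite invr1 subrr powRr0 mul1r powRr1; last first.
    by apply: sumr_ge0 => i _; exact: powR_ge0.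
  by apply: ler_sum => i _; rewrite powRr1.
have {rn1} r1' : 1 < r by rewrite lt_neqAle eq_sym rn1.
set S := \sum_(i | A i) powR (x i) r.
have S0 : 0 <= S by apply: sumr_ge0 => i _; exact: powR_ge0.
have [S00|Sn0] := eqVneq S 0.
  rewrite big1 ?mulr_ge0 ?powR_ge0// => i Ai.
  apply: (@powR_eq0_eq0 _ _ r); apply/eqP.
  move/eqP : S00; rewrite psumr_eq0 => [/allP/(_ i)|? _]; last exact: powR_ge0.
  by rewrite mem_index_enum Ai => /(_ isT).
have Sp : 0 < S by rewrite lt_def Sn0.
have n0 : 0 < n.
  apply: lt_le_trans An; rewrite ltr0n lt0n; apply: contra_neq Sn0 => A0.
  by rewrite /S big1// => i Ai; move/card0_eq/(_ i) : A0; rewrite unfold_in Ai.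
pose M := powR S r^-1; have M0 : 0 < M by exact: powR_gt0.
pose r' := (1 - r^-1)^-1.
have ri : r^-1 < 1 by rewrite invf_lt1.
have r'0 : 0 < r' by rewrite invr_gt0 subr_gt0.
have rr' : r^-1 + r'^-1 = 1 by rewrite /r' invrK; lra.
(* The factor [c] satisfies c^r' = 1/n, so the right-hand sides of Young's inequality sum to at most
   1/r + 1/r' = 1. *)
pose c := powR n (- (1 - r^-1)).
have MrS : powR M^-1 r = S^-1.
  by rewrite -(powR_inv1 (ltW M0)) -!powRrM mulrCA mulVf ?gt_eqF// mulr1 powR_inv1.
have young i : A i -> x i / M * c <= powR (x i) r / S / r + n^-1 / r'.
  move=> Ai.
  have := @conjugate_powR _ (x i / M) c r r'.
  rewrite divr_ge0 ?(ltW M0)// /c powR_ge0 => /(_ isT isT r0 r'0 rr').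
  rewrite -powRrM mulNr -/r' (_ : (1 - r^-1) * r' = 1); last first.
    by rewrite /r' divff// gt_eqF// subr_gt0.
  rewrite powR_inv1 ?(ltW n0)// powRM ?invr_ge0 ?(ltW M0)//.
  by rewrite MrS.
have : \sum_(i | A i) (x i / M * c) <= 1.
  apply: (@le_trans _ _ (\sum_(i | A i) (powR (x i) r / S / r + n^-1 / r'))).
    exact: ler_sum.
  rewrite big_split /= -!mulr_suml divff ?gt_eqF// sumr_const.
  rewrite div1r -[X in _ <= X]rr' lerD2l ler_piMl//; first by rewrite invr_ge0 ltW.
  by rewrite -mulr_natl ler_pdivrMr// mul1r.
rewrite -!mulr_suml mulrAC ler_pdivrMr// mul1r /c powRN ler_pdivrMr ?powR_gt0//.
by rewrite mulrC.
Qed.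


(** Half of the exponential rate absorbs the polynomial factor; the other half leaves a geometric
    series, whose bound does not depend on [K]. *)
Lemma sum_poly_expR_bounded (d : R) (n : nat) : 0 < d ->
  exists2 C : R, 0 <= C & forall K,
    \sum_(h < K) expR (- (d * h%:R)) * h.+1%:R ^+ n <= C.
Proof.
move=> d0.
(* With u <= 1, the inequality 1 + x <= exp x gives h + 1 <= u^-1 exp (u h). The second entry of the
   minimum makes the n-th power of this cost at most the rate d / 2. *)
pose u := Num.min 1 (d / (2 * n.+1%:R)).
have u0 : 0 < u.
  by rewrite /u lt_min ltr01/= divr_gt0// mulr_gt0// ltr0n.
have u1 : u <= 1 by rewrite /u ge_min lexx.
have und : u * n%:R <= d / 2.
  apply: (@le_trans _ _ (d / (2 * n.+1%:R) * n.+1%:R)).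
    rewrite ler_pM ?(ltW u0)//; first by rewrite /u ge_min lexx orbT.
    by rewrite ler_nat.
  by rewrite invfM mulrA -mulrA mulVf ?mulr1// pnatr_eq0.
have hexp h : h.+1%:R <= u^-1 * expR (u * h%:R).
  rewrite -ler_pdivrMl ?invr_gt0// invrK.
  apply: le_trans (expR_ge1Dx _).
  by rewrite -natr1; nra.
pose y := expR (- (d / 2)).
have y1 : y < 1 by rewrite expR_lt1; lra.
exists (u^-1 ^+ n * (1 - y)^-1).
  by rewrite mulr_ge0 ?exprn_ge0 ?invr_ge0 ?(ltW u0)// subr_ge0 ltW.
move=> K.
apply: (@le_trans _ _ (\sum_(h < K) u^-1 ^+ n * y ^+ h)).
  apply: ler_sum => h _.
  have : h.+1%:R ^+ n <= u^-1 ^+ n * expR (u * n%:R * h%:R).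
    rewrite (mulrAC u) [X in expR X]mulrC expRM_natl -exprMn.
    by rewrite lerXn2r ?nnegrE// mulr_ge0 ?invr_ge0 ?(ltW u0)// expR_ge0.
  move=> /(@ler_wpM2l _ (expR (- (d * h%:R))) (expR_ge0 _)) /le_trans; apply.
  rewrite mulrCA ler_wpM2l ?exprn_ge0 ?invr_ge0 ?(ltW u0)//.
  rewrite -expRD /y -[X in _ <= X]expRM_natl ler_expR mulrN [X in _ <= - X]mulrC.
  have : 0 <= h%:R :> R by [].
  nra.
rewrite -mulr_sumr ler_wpM2l ?exprn_ge0 ?invr_ge0 ?(ltW u0)//.
rewrite -[X in _ <= X]mul1r ler_pdivlMr ?subr_gt0//.
have -> : (\sum_(h < K) y ^+ h) * (1 - y) = 1 - y ^+ K.
  by rewrite -(opprB y) mulrN mulrC -subrX1 opprB.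
by rewrite gerBl exprn_ge0// expR_ge0.
Qed.

End FiniteSums.

(** * Univariate Haar functions in terms of b-adic cells *)

Section DigitIntervals.
Context {R : realType} (b : nat).
Hypothesis b0 : (0 < b)%N.

(* Index of the b-adic interval of length b^-d containing x >= 0. *)
Definition cell1 (d : nat) (x : R) : nat := Num.truncn (x * b%:R ^+ d).

Lemma cell1_eqE (d a : nat) (x : R) : 0 <= x ->
  (a%:R * b%:R ^- d <= x) && (x < a.+1%:R * b%:R ^- d) = (cell1 d x == a).
Proof.
move=> x0; have bd : 0 < b%:R ^+ d :> R by rewrite exprn_gt0// ltr0n.
rewrite ler_pdivrMr// ltr_pdivlMr//; apply/idP/eqP => [h|<-].
  by apply: truncn_def.
by apply: truncn_itv; rewrite mulr_ge0// ltW.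
Qed.

Lemma cell1_div (d : nat) (x : R) : 0 <= x -> (cell1 d.+1 x %/ b)%N = cell1 d x.
Proof.
move=> x0; apply/esym/eqP; rewrite -cell1_eqE//.
have bd n : 0 < b%:R ^+ n :> R by rewrite exprn_gt0// ltr0n.
have := eqxx (cell1 d.+1 x); rewrite -cell1_eqE// => /andP[].
rewrite !ler_pdivrMr// !ltr_pdivlMr//.
set n := cell1 d.+1 x => n1 n2.
rewrite -(ler_pM2r (_ : 0 < b%:R)) ?ltr0n//.
rewrite -(ltr_pM2r (_ : 0 < b%:R)) ?ltr0n//.
rewrite -mulrA -exprSr -!natrM; apply/andP; split.
  by apply: le_trans n1; rewrite ler_nat leq_trunc_div.
by apply: (lt_le_trans n2); rewrite ler_nat ltn_ceil.
Qed.

(** A cell is the disjoint union of its b children: the child containing x is singled out by the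
    last digit [n %% b]. *)
Lemma cell1_split (d a : nat) (x : R) : 0 <= x ->
  (cell1 d x == a :> nat) = (\sum_(c < b) (cell1 d.+1 x == b * a + c))%N :> nat.
Proof.
move=> x0; rewrite -(cell1_div d x0); set n := cell1 d.+1 x.
have nb : (n %% b < b)%N by rewrite ltn_mod.
have nE := divn_eq n b.
rewrite (bigD1 (Ordinal nb))//= big1 ?addn0; last first.
  move=> c cn; apply/eqP; rewrite eqb0; apply: contraNN cn => /eqP nc.
  by apply/eqP/val_inj => /=; rewrite nc mulnC modnMDl modn_small.
congr nat_of_bool; apply/eqP/eqP => [<-|h]; first by rewrite mulnC.
by apply/eqP; rewrite -(eqn_pmul2l b0) -(eqn_add2r (n %% b)) -h mulnC -nE.
Qed.

Lemma haar1_cell (j i k : nat) (x : R) : 0 <= x -> (k < b ^ (j - 1))%N ->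
  haar1 b j i k x = if j == 0%N then (cell1 0 x == k)%:R
    else powR b%:R (j%:R / 2 - 1) *
         (b%:R * (cell1 j x == b * k + i)%N%:R - (cell1 j.-1 x == k)%:R).
Proof.
move=> x0; rewrite /haar1; case: j => [|j] /=.
  rewrite expn0 ltnS leqn0 => /eqP ->; rewrite -cell1_eqE//.
  by rewrite expr0 mul0r invr1 mulr1.
move=> _; rewrite -!cell1_eqE// addn1.
by rewrite ![b%:R ^- _ * _]mulrC.
Qed.

(** The value of the Haar function on the c-th child of its support. On level 0 there is only one
    cell, and the other b - 1 weights are 0, so that one sum over c < b serves all levels. *)
Definition haar1_weight (j i c : nat) : R :=
  if j == 0%N then (c == 0%N)%:R
  else powR b%:R (j%:R / 2 - 1) * (b%:R * (c == i)%:R - 1).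

Lemma haar1_expand (j i k : nat) (x : R) : 0 <= x -> (k < b ^ (j - 1))%N ->
  (i < if j == 0%N then 1 else b)%N ->
  haar1 b j i k x =
  \sum_(c < b) haar1_weight j i c * (cell1 j x == b * k + c)%N%:R.
Proof.
move=> x0 kb ib; rewrite haar1_cell// /haar1_weight.
have [j0|j0] := eqVneq j 0%N.
  move: kb; rewrite j0 expn0 ltnS leqn0 => /eqP ->.
  rewrite (bigD1 (Ordinal b0))//= big1 ?addr0 ?mul1r ?muln0//.
  by move=> c; rewrite -val_eqE /= => /negbTE ->; rewrite mul0r.
rewrite (negbTE j0) in ib.
under eq_bigr do rewrite -mulrA.
rewrite -mulr_sumr; congr (_ * _).
under eq_bigr do rewrite mulrBl mul1r.
rewrite sumrB; congr (_ - _).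
  rewrite (bigD1 (Ordinal ib))//= big1 ?addr0 ?eqxx ?mulr1//.
  by move=> c; rewrite -val_eqE /= => /negbTE ->; rewrite mulr0 mul0r.
rewrite -natr_sum; congr (_%:R).
case: j j0 {kb} => // j _ /=.
by rewrite -cell1_split.
Qed.

(** The mean of a Haar function of positive level vanishes: the peak b cancels b times the constant
    1. *)
Lemma haar1_weight_sum (j i : nat) : (0 < j)%N -> (i < b)%N ->
  \sum_(c < b) haar1_weight j i c = 0.
Proof.
move=> j0 ib; rewrite /haar1_weight gtn_eqF// -mulr_sumr.
rewrite sumrB sumr_const card_ord -mulr_sumr (bigD1 (Ordinal ib))//=.
rewrite eqxx big1 ?addr0 ?mulr1 ?subrr ?mulr0//.
by move=> c; rewrite -val_eqE /= => /negbTE ->.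
Qed.

(** On the support the bracket b 1 - 1 is at most b in absolute value, which uses up the factor b^-1
    of the normalisation. The support is the cell of order j - 1; truncated subtraction makes this
    right for j = 0 too. *)
Lemma haar1_bound (j i k : nat) (x : R) : 0 <= x -> (k < b ^ (j - 1))%N ->
  (i < if j == 0%N then 1 else b)%N ->
  `|haar1 b j i k x| <= powR b%:R (j%:R / 2) * (cell1 (j - 1) x == k)%:R.
Proof.
move=> x0 kb ib; rewrite haar1_cell//.
have b1 : 1 <= b%:R :> R by rewrite ler1n.
case: j kb ib => [|j] /= kb ib.
  by rewrite mul0r powRr0 mul1r ger0_norm.
rewrite subn1 /= -(cell1_div j x0); set n := cell1 _ _.
have [nk|nk] := eqVneq (n %/ b)%N k; last first.
  suff /negbTE -> : n != (b * k + i)%N by rewrite !mulr0 subrr mulr0 normr0.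
  by apply: contraNneq nk => ->; rewrite mulnC divnMDl// divn_small// addn0.
rewrite mulr1 powRB; last by apply/implyP => _; rewrite pnatr_eq0 -lt0n.
rewrite powRr1 ?ler0n// normrM ger0_norm ?divr_ge0 ?powR_ge0//.
rewrite -mulrA ler_piMr ?powR_ge0// mulrC ler_pdivrMr ?ltr0n// mul1r.
by case: (_ == _); rewrite ?mulr1 ?mulr0 ?sub0r ?normrN1// ger0_norm ?subr_ge0// gerBl.
Qed.

End DigitIntervals.

(** * Counting net points in cells of any order *)

Section Nets.
Context {R : realType} {s : nat} (b : nat).
Hypothesis b0 : (0 < b)%N.

Definition in_cell (d a : 'I_s -> nat) (x : s.-tuple R) : bool :=
  [forall l, cell1 b (d l) (tnth x l) == a l].

Lemma forallbD1 (I : finType) (i0 : I) (F : pred I) :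
  [forall i, F i] = F i0 && [forall i, (i != i0) ==> F i].
Proof.
apply/forallP/andP => [h|[h0 /forallP h] i].
  by split => //; apply/forallP => i; rewrite h implybT.
by have [->//|ii0] := eqVneq i i0; have := h i; rewrite ii0.
Qed.

Lemma in_cell_split (l0 : 'I_s) (d a : 'I_s -> nat) (x : s.-tuple R) :
  (forall l, 0 <= tnth x l) ->
  in_cell d a x = (\sum_(c < b) in_cell
    (fun l => if l == l0 then (d l).+1 else d l)
    (fun l => if l == l0 then b * a l + c else a l) x)%N :> nat.
Proof.
move=> x0; rewrite /in_cell.
under eq_bigr => c _ do rewrite (forallbD1 l0) /= eqxx -mulnb.
rewrite (forallbD1 l0) /= -mulnb (cell1_split b0)// big_distrl /=.
apply: eq_bigr => c _; congr (_ * nat_of_bool _)%N.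
by apply: eq_forallb => l; case: eqVneq.
Qed.

Lemma count_sum (T : Type) (a : pred T) (P : seq T) :
  count a P = (\sum_(x <- P) a x)%N.
Proof. by rewrite -sum1_count big_mkcond; apply: eq_bigr => x _; case: (a x). Qed.

Lemma sum_upd (l0 : 'I_s) (d : 'I_s -> nat) :
  (\sum_l (if l == l0 then (d l).+1 else d l) = (\sum_l d l).+1)%N.
Proof.
rewrite (bigD1 l0)//= eqxx [in RHS](bigD1 l0)//= addSn; congr (_ + _).+1.
by apply: eq_bigr => l /negbTE ->.
Qed.

Variables (t m : nat) (P : seq (s.-tuple R)).
Hypothesis netP : is_net b t m P.

Lemma net_ge0 x : x \in P -> forall l, 0 <= tnth x l.
Proof. by case: netP => _ _ h _ /h xP l; case/andP : (xP l). Qed.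

Lemma net_count_base (d a : 'I_s -> nat) : (forall l, a l < b ^ d l)%N ->
  (\sum_(l < s) d l = m - t)%N -> count (in_cell d a) P = (b ^ t)%N.
Proof.
move=> ad dm; case: netP => _ _ _ /(_ d a ad dm) <-.
apply: eq_in_count => x /net_ge0 x0; apply: eq_forallb => l.
by rewrite cell1_eqE.
Qed.

(** Induction on the gap between |d| and m - t: cutting the cell into b children along the
    coordinate [l0] raises the order by one, until the net property applies. *)
Lemma net_count_eq (l0 : 'I_s) (d a : 'I_s -> nat) :
  (forall l, a l < b ^ d l)%N -> (\sum_(l < s) d l <= m - t)%N ->
  count (in_cell d a) P = (b ^ (m - \sum_(l < s) d l))%N.
Proof.
have tm : (t <= m)%N by case: netP.
move=> + dm; have [k kE] : {k | k = m - t - \sum_(l < s) d l}%N by eexists.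
elim: k d a dm kE => [|k IH] d a dm kE ad.
  have dE : (\sum_(l < s) d l = m - t)%N by lia.
  by rewrite net_count_base// dE subKn.
rewrite count_sum (eq_big_seq (fun x => (\sum_(c < b) in_cell
    (fun l => if l == l0 then (d l).+1 else d l)
    (fun l => if l == l0 then b * a l + c else a l) x)%N)); last first.
  by move=> x /net_ge0 x0; rewrite -in_cell_split.
rewrite exchange_big /=.
transitivity (\sum_(c < b) b ^ (m - (\sum_(l < s) d l).+1))%N; last first.
  rewrite sum_nat_const card_ord -expnS; congr expn.
  by move: dm kE; move: (\sum_(l < s) d l)%N => S; lia.
apply: eq_bigr => c _; rewrite -count_sum IH ?sum_upd//;
  [by move: dm kE; move: (\sum_(l < s) d l)%N => S; lia..|].
move=> l; case: eqP => // _; rewrite expnS.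
apply: (@leq_trans (b * (a l).+1)); last by rewrite leq_mul2l ad orbT.
by rewrite mulnS addnC ltn_add2r.
Qed.

(** Induction on the excess of |d| over m - t: dropping the last digit in a coordinate of positive
    order replaces the cell by a larger one, which can only gain points. *)
Lemma net_count_le (d a : 'I_s -> nat) :
  (forall l, a l < b ^ d l)%N -> (m - t <= \sum_(l < s) d l)%N ->
  (count (in_cell d a) P <= b ^ t)%N.
Proof.
move=> + dm; have [k kE] : {k | k = \sum_(l < s) d l - (m - t)}%N by eexists.
elim: k d a dm kE => [|k IH] d a dm kE ad.
  by rewrite net_count_base//; lia.
have [l0 dl0] : exists l0, (0 < d l0)%N.
  apply/existsP; apply: contraT => /existsPn d0.
  by move: kE; rewrite big1// => l _; apply/eqP; rewrite -leqn0 leqNgt d0.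
pose d' := fun l => if l == l0 then (d l).-1 else d l.
have dE : (\sum_l d l = (\sum_l d' l).+1)%N.
  rewrite -(sum_upd l0); apply: eq_bigr => l _; rewrite /d'.
  by case: eqP => // ->; rewrite prednK.
pose a' := fun l => if l == l0 then (a l %/ b)%N else a l.
have d'm : (m - t <= \sum_l d' l)%N.
  by move: kE; rewrite dE; move: (\sum_l d' l)%N => S; lia.
have kE' : (k = \sum_l d' l - (m - t))%N.
  by move: kE; rewrite dE; move: (\sum_l d' l)%N => S; lia.
have ad' l : (a' l < b ^ d' l)%N.
  rewrite /a' /d'; case: eqP => // ->.
  by rewrite ltn_divLR// -expnSr prednK.
apply: leq_trans (IH d' a' d'm kE' ad').
rewrite !count_sum [leqLHS]big_seq_cond [leqRHS]big_seq_cond.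
apply: leq_sum => x; rewrite andbT => /net_ge0 x0.
case: (boolP (in_cell d a x)) => //= /forallP xc.
suff -> : in_cell d' a' x by [].
apply/forallP => l; rewrite /d' /a'; have [->|_] := eqVneq l l0; last exact: xc.
by rewrite -(eqP (xc l0)) -{2}(prednK dl0) cell1_div.
Qed.

Lemma in_cell0 (x : s.-tuple R) : (forall l, 0 <= tnth x l < 1) ->
  in_cell (fun=> 0%N) (fun=> 0%N) x.
Proof.
move=> x01; apply/forallP => l; have /andP[x0 x1] := x01 l.
by rewrite -cell1_eqE// expr0 mul0r invr1 mulr1 x0 x1.
Qed.

Lemma net_size (l0 : 'I_s) : size P = (b ^ m)%N.
Proof.
have := @net_count_eq l0 (fun=> 0%N) (fun=> 0%N).
rewrite big1// subn0 => <- //.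
apply/esym/eqP; rewrite -all_count; apply/allP => x xP; apply: in_cell0.
by case: netP => _ _ h _; exact: h.
Qed.

(** Expanding the tensor product writes the Haar function through cells of order j. Each contains
    the same number of net points, so the sum factorises into sums of weights, one of which vanishes
    because some j l is positive. *)
Lemma net_haar_sum (l0 : 'I_s) (j i k : 'I_s -> nat) :
  (forall l, k l < b ^ (j l - 1))%N ->
  (forall l, i l < if j l == 0%N then 1 else b)%N ->
  (0 < \sum_(l < s) j l <= m - t)%N ->
  \sum_(x <- P) haar b j i k x = 0.
Proof.
move=> kb ib /andP[j0 jm].
rewrite (eq_big_seq (fun x => \sum_(c : {ffun 'I_s -> 'I_b})
  (\prod_l haar1_weight b (j l) (i l) (c l)) *
  (in_cell j (fun l => b * k l + c l)%N x)%:R)); last first.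
  move=> x /net_ge0 x0; rewrite /haar.
  under eq_bigr => l _ do rewrite (@haar1_expand _ _ b0)//.
  rewrite bigA_distr_bigA /=; apply: eq_bigr => c _.
  rewrite big_split /=; congr (_ * _).
  rewrite /in_cell; case: (boolP [forall _, _]) => [/forallP h|].
    by rewrite big1// => l _; rewrite h.
  rewrite negb_forall => /existsP[l hl].
  by rewrite (bigD1 l)//= (negbTE hl) mul0r.
rewrite exchange_big /=.
under eq_bigr do rewrite -mulr_sumr -natr_sum -count_sum.
transitivity (\sum_(c : {ffun 'I_s -> 'I_b})
  (\prod_l haar1_weight b (j l) (i l) (c l)) * (b ^ (m - \sum_l j l))%:R : R).
  apply: eq_bigr => c _.
  (* The cell index can leave the grid only in a coordinate with j l = 0 and c l > 0; there the
     weight is 0, so both sides vanish. *)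
  have [h|] := boolP [forall l, (b * k l + c l < b ^ j l)%N].
    by rewrite (net_count_eq l0)//; exact/forallP.
  rewrite negb_forall => /existsP[l hl].
  rewrite (bigD1 l)//= {1 3}/haar1_weight.
  case: (eqVneq (j l) 0%N) (kb l) (ib l) hl => [->|jl kl _ /negP[]].
    rewrite expn0 ltnS leqn0 => /eqP -> _.
    by rewrite muln0 add0n -leqNgt; case: (c l : nat) => //= ? _; rewrite !mul0r.
  rewrite -(prednK (_ : 0 < j l)%N) ?lt0n// expnS.
  apply: (@leq_trans (b * (k l).+1)); last by rewrite leq_mul2l -subn1 kl orbT.
  by rewrite mulnS addnC ltn_add2r.
rewrite -mulr_suml
  -(bigA_distr_bigA (fun l (c : 'I_b) => haar1_weight b (j l) (i l) c)).
have [l jl] : exists l, (0 < j l)%N.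
  apply/existsP; apply: contraT => /existsPn jn.
  by move: j0; rewrite big1// => l _; apply/eqP; rewrite -leqn0 leqNgt jn.
rewrite (bigD1 l)//= haar1_weight_sum ?mul0r//.
by have := ib l; rewrite gtn_eqF.
Qed.

(* The support of a level-j Haar function is a cell of order j - 1, truncated at 0. *)
Lemma net_count_support (l0 : 'I_s) (j k : 'I_s -> nat) :
  (forall l, k l < b ^ (j l - 1))%N -> (m - t < \sum_(l < s) j l)%N ->
  (count (in_cell (fun l => j l - 1)%N k) P <= b ^ (t + s))%N.
Proof.
move=> kb jm.
have tm : (t <= m)%N by case: netP.
(* Passing from j to j - 1 lowers the order by at most s, which is where the factor b^s in the count
   comes from. *)
have js : (\sum_(l < s) j l <= \sum_(l < s) (j l - 1) + s)%N.
  rewrite -[X in (_ + X)%N]card_ord -sum1_card -big_split /=.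
  by apply: leq_sum => l _; lia.
have [h|h] := leqP (m - t) (\sum_(l < s) (j l - 1))%N.
  by apply: leq_trans (net_count_le kb h) _; rewrite leq_pexp2l// leq_addr.
rewrite (net_count_eq l0 kb (ltnW h)) leq_pexp2l//.
move: js jm h tm; move: (\sum_(l < s) j l)%N (\sum_(l < s) (j l - 1))%N => S S'.
by lia.
Qed.

End Nets.

(** * The faces of the cube are null, and the level-0 coefficient is the integral *)

Section UnitCube.
Context {R : realType} {s : nat}.

Lemma measurable_box (B : 'I_s -> set R) : (forall l, measurable (B l)) ->
  measurable [set x : s.-tuple R | forall l, B l (tnth x l)].
Proof.
move=> mB.
rewrite [X in measurable X](_ : _ =
    \bigcap_(l in [set: 'I_s]) ((fun x : s.-tuple R => tnth x l) @^-1` B l)).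
  apply: fin_bigcap_measurable => // l _.
  by rewrite -[X in measurable X]setTI; exact: measurable_tnth.
by apply/seteqP; split => x /= h => [l _|l]; exact: h.
Qed.

Definition boxo (c : R) : set (s.-tuple R) := [set x | forall l, 0 <= tnth x l < c].

Lemma measurable_boxo c : measurable (boxo c).
Proof.
have -> : boxo c = [set x | forall l, `[0, c[%classic (tnth x l)].
  by apply/seteqP; split => x /= h l; have := h l; rewrite /= in_itv.
exact: (@measurable_box (fun=> `[0, c[%classic)).
Qed.

Lemma measurable_cube : measurable (@cube R s).
Proof.
have -> : @cube R s = [set x | forall l, `[0, 1]%classic (tnth x l)].
  by apply/seteqP; split => x /= h l; have := h l; rewrite /= in_itv.
exact: (@measurable_box (fun=> `[0, 1]%classic)).
Qed.

(** The chord of the convex function (1 + e)^n over [0, 1]; it bounds the volume of a thin shell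
    around the cube. *)
Lemma exprD1_le (e : R) n : 0 <= e <= 1 -> (1 + e) ^+ n <= 1 + e * (2 ^+ n - 1).
Proof.
move=> /andP[e0 e1]; elim: n => [|n IH]; first by rewrite !expr0; lra.
have n1 : 1 <= 2 ^+ n :> R by rewrite exprn_ege1// ler1n.
rewrite !exprS; apply: (@le_trans _ _ ((1 + e) * (1 + e * (2 ^+ n - 1)))).
  by rewrite ler_wpM2l//; lra.
have : e * (e * (2 ^+ n - 1)) <= e * (2 ^+ n - 1).
  by rewrite ler_piMl// mulr_ge0// subr_ge0.
nra.
Qed.

Variable lam : {measure set (s.-tuple R) -> \bar R}.
Hypothesis lamE : forall a c : s.-tuple R, (forall l, tnth a l <= tnth c l) ->
  lam [set x | forall l, tnth a l <= tnth x l < tnth c l]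
  = (\prod_(l < s) (tnth c l - tnth a l))%:E.

Lemma lam_boxo c : 0 <= c -> lam (boxo c) = (c ^+ s)%:E.
Proof.
move=> c0.
have -> : boxo c = [set x | forall l, tnth [tuple of nseq s 0] l <= tnth x l
    < tnth [tuple of nseq s c] l].
  by apply/seteqP; split => x /= h l; have := h l; rewrite !tnth_nseq.
rewrite lamE => [|l]; last by rewrite !tnth_nseq.
under eq_bigr do rewrite !tnth_nseq subr0.
by rewrite prodr_const card_ord.
Qed.

(** The measure is given on half-open boxes only. The upper faces lie in the shell between [boxo 1]
    and [boxo (1 + d)], of volume (1 + d)^s - 1, which is small with d. *)
Lemma cube_boundary_null : lam (@cube R s `\` boxo 1) = 0%E.
Proof.
have mN : measurable (@cube R s `\` boxo 1).
  by apply: measurableD; [exact: measurable_cube|exact: measurable_boxo].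
apply/eqP; rewrite -measure_le0; apply/lee_addgt0Pr => e e0.
rewrite add0e.
pose d := Num.min 1 (e / 2 ^+ s).
have d0 : 0 < d by rewrite lt_min ltr01 divr_gt0// exprn_gt0.
have d1 : d <= 1 by rewrite ge_min lexx.
have sub : boxo 1 `<=` boxo (1 + d).
  by move=> x h l; have /andP[-> /= xl] := h l; rewrite (lt_trans xl)// ltrDl.
have d0' : 0 <= 1 + d by lra.
have h : ((1 + d) ^+ s)%:E = (1 + lam (boxo (1 + d) `\` boxo 1))%E.
  rewrite -(lam_boxo d0') -[in LHS](setDUK sub) measureU ?setDIK//.
  - by congr (_ + _)%E; have := lam_boxo ler01; rewrite expr1n.
  - exact: measurable_boxo.
  - by apply: measurableD; exact: measurable_boxo.
apply: (@le_trans _ _ (lam (boxo (1 + d) `\` boxo 1))).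
  apply: le_measure; rewrite ?inE//.
    by apply: measurableD; exact: measurable_boxo.
  apply: setSD => x h' l; have /andP[-> /= xl] := h' l.
  by rewrite (le_lt_trans xl)// ltrDl.
rewrite -(@leeD2lE _ 1%E)// -h.
rewrite -EFinD lee_fin (le_trans (exprD1_le _ _)) ?(ltW d0)// lerD2l.
apply: (@le_trans _ _ (d * 2 ^+ s)); first by rewrite ler_pM2l// gerBl.
by rewrite -ler_pdivlMr ?exprn_gt0// /d ge_min lexx orbT.
Qed.

Lemma haar_level0 b (j i k : 'I_s -> nat) (x : s.-tuple R) :
  (forall l, j l = 0%N) -> haar b j i k x = \1_(boxo 1) x.
Proof.
move=> j0; rewrite /haar /haar1; under eq_bigr do rewrite j0 eqxx.
rewrite indicE; case: (boolP (x \in _)); rewrite ?inE ?notin_setE => h.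
  by rewrite big1// => l _; rewrite h.
have [l xl] : exists l, ~~ (0 <= tnth x l < 1).
  by apply/existsP; rewrite -negb_forall; apply/negP => /forallP.
by rewrite (bigD1 l)//= (negbTE xl) mul0r.
Qed.

(** The level-0 Haar function is 1 on the closed cube except on the upper faces, which are null. *)
Lemma coef_level0 b (f : s.-tuple R -> R) (j i k : 'I_s -> nat) :
  (forall l, j l = 0%N) -> lam.-integrable (@cube R s) (EFin \o f) ->
  coef lam b f j i k = \int[lam]_(x in @cube R s) f x.
Proof.
move=> j0 fint; rewrite /coef.
under eq_Rintegral do rewrite haar_level0//.
have -> : (fun x => f x * \1_(boxo 1) x) = f \_ (boxo 1).
  by apply/funext => x; rewrite patchE indicE; case: (_ \in _); rewrite ?mulr1 ?mulr0.
rewrite -Rintegral_mkcondr /Rintegral; congr fine.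
rewrite [RHS](negligible_integral _ measurable_cube fint cube_boundary_null).
  by rewrite setDD.
by apply: measurableD; [exact: measurable_cube|exact: measurable_boxo].
Qed.

End UnitCube.

(** * The contribution of one index j to the cubature sum *)

Section LevelBound.
Context {R : realType} {s : nat}.
Variables (lam : {measure set (s.-tuple R) -> \bar R}) (b : nat).
Hypothesis b0 : (0 < b)%N.

Lemma prod_powR (I : finType) (a : R) (e : I -> R) : 0 < a ->
  \prod_i powR a (e i) = powR a (\sum_i e i).
Proof.
move=> a0; elim/big_rec2 : _ => [|i x y _ ->]; first by rewrite powRr0.
by rewrite powRD// (gt_eqF a0) implybT.
Qed.

Lemma haar_bound (j i k : 'I_s -> nat) (x : s.-tuple R) :
  (forall l, 0 <= tnth x l) -> (forall l, k l < b ^ (j l - 1))%N ->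
  (forall l, i l < if j l == 0%N then 1 else b)%N ->
  `|haar b j i k x| <= powR b%:R ((\sum_l j l)%N%:R / 2)
                        * (in_cell b (fun l => j l - 1)%N k x)%:R.
Proof.
move=> x0 kb ib; rewrite /haar normr_prod.
apply: (@le_trans _ _ (\prod_l (powR b%:R ((j l)%:R / 2) *
    (cell1 b (j l - 1) (tnth x l) == k l)%:R))).
  by apply: ler_prod => l _; rewrite normr_ge0 haar1_bound.
rewrite big_split /= prod_powR ?ltr0n// -mulr_suml -natr_sum.
rewrite ler_wpM2l ?powR_ge0//.
have [h|] := boolP (in_cell _ _ _ _).
  by rewrite big1// => l _; rewrite (forallP h).
by rewrite negb_forall => /existsP[l /negbTE hl]; rewrite (bigD1 l)//= hl mul0r.
Qed.

Variables (p : \bar R) (f : s.-tuple R -> R) (j : 'I_s -> nat).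
Hypothesis p1 : (1 <= p)%E.

Local Notation Kt := {dffun forall l : 'I_s, 'I_(b ^ (j l - 1))}.
Local Notation It := {dffun forall l : 'I_s, 'I_(if j l == 0%N then 1%N else b)}.
Local Notation c k i := (coef lam b f j (fun l => (i : It) l : nat)
                                       (fun l => (k : Kt) l : nat)).

Lemma lpnorm_ge0 : 0 <= lpnorm lam b p f j.
Proof. by rewrite /lpnorm; case: p => [r||]; rewrite ?powR_ge0// bigmax_ge_id. Qed.

Lemma sum_le_lpnorm (A : pred (Kt * It)) (n : R) : #|A|%:R <= n ->
  \sum_(z | A z) `|c z.1 z.2| <= powR n (1 - recip p) * lpnorm lam b p f j.
Proof.
move=> An; have n0 : 0 <= n by apply: le_trans An.
rewrite /recip /lpnorm; case: p p1 => [r| |]//=.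
  rewrite lee_fin => r1.
  have r0 : 0 < r by lra.
  apply: le_trans (sum_le_card_powR r1 _ An) _ => //.
  rewrite ler_wpM2l ?powR_ge0// ge0_ler_powR ?invr_ge0 ?(ltW r0)// ?nnegrE.
  - by apply: sumr_ge0 => z _; exact: powR_ge0.
  - by apply: sumr_ge0 => k _; apply: sumr_ge0 => i _; exact: powR_ge0.
  rewrite pair_big /= [leRHS](bigID A) /= lerDl.
  by apply: sumr_ge0 => z _; exact: powR_ge0.
move=> _; rewrite subr0 powRr1//; set M := \big[_/_]_k _.
have M0 : 0 <= M by exact: bigmax_ge_id.
apply: (@le_trans _ _ (\sum_(z | A z) M)).
  apply: ler_sum => -[k i] _ /=.
  by apply: le_trans (le_bigmax _ _ k); exact: le_bigmax.
by rewrite sumr_const -mulr_natl ler_wpM2r.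
Qed.

Lemma card_indices_le : (#|{: It}| <= b ^ s)%N.
Proof.
rewrite card_dep_ffun foldrE big_map big_enum /=.
rewrite -[in leqRHS](card_ord s) -prod_nat_const; apply: leq_prod => l _.
by rewrite card_ord; case: eqP.
Qed.

Lemma card_cells_le1 (x : s.-tuple R) :
  (\sum_(k : Kt) in_cell b (fun l => j l - 1)%N (fun l => k l : nat) x <= 1)%N.
Proof.
rewrite -count_sum -sum1_count sum1_card.
apply/card_le1_eqP => k k' /forallP h /forallP h'.
apply/ffunP => l; apply/val_inj/eqP.
by rewrite /= -(eqP (h l)) -(eqP (h' l)).
Qed.

(** Each coefficient is met at most C times, with height at most b^(|j|/2). Hölder is applied only
    to the pairs (k, i) whose support meets P, so their number is governed by the size of P and not
    by |j|. *)
Lemma sum_level_bound (P : seq (s.-tuple R)) (C : nat) :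
  (forall x, x \in P -> forall l, 0 <= tnth x l) ->
  (forall k : Kt, count (in_cell b (fun l => j l - 1)%N (fun l => k l : nat)) P <= C)%N ->
  \sum_(x <- P) `|\sum_(k : Kt) \sum_(i : It)
      c k i * haar b j (fun l => i l : nat) (fun l => k l : nat) x|
  <= powR b%:R ((\sum_l j l)%N%:R / 2) * C%:R *
     (powR (size P * b ^ s)%N%:R (1 - recip p) * lpnorm lam b p f j).
Proof.
move=> P0 PC.
pose cl (k : Kt) := in_cell b (fun l => j l - 1)%N (fun l => k l : nat) : pred (s.-tuple R).
pose A := [pred z : Kt * It | (0 < count (cl z.1) P)%N].
set B := powR b%:R _.
(* Each point lies in at most one cell k of the given order, and there are at most b^s choices of
   i. *)
have cardA : (#|A| <= size P * b ^ s)%N.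
  apply: (@leq_trans (\sum_(z : Kt * It) count (cl z.1) P)).
    rewrite -sum1_card big_mkcond /=; apply: leq_sum => z _.
    by rewrite unfold_in /=; case: ifP.
  rewrite -(pair_bigA _ (fun k (_ : It) => count (cl k) P)) /= exchange_big /=.
  rewrite sum_nat_const mulnC leq_mul ?card_indices_le//.
  under eq_bigr do rewrite count_sum.
  rewrite exchange_big /= -sum1_size; apply: leq_sum => x _.
  exact: card_cells_le1.
apply: (@le_trans _ _ (\sum_(x <- P) \sum_(k : Kt) \sum_(i : It)
    `|c k i| * (B * (cl k x)%:R))).
  rewrite big_seq [leRHS]big_seq; apply: ler_sum => x xP.
  apply: le_trans (ler_norm_sum _ _ _) _; apply: ler_sum => k _.
  apply: le_trans (ler_norm_sum _ _ _) _; apply: ler_sum => i _.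
  by rewrite normrM ler_wpM2l// haar_bound//; exact: P0.
have -> : \sum_(x <- P) \sum_(k : Kt) \sum_(i : It) `|c k i| * (B * (cl k x)%:R) =
    B * \sum_(z : Kt * It) `|c z.1 z.2| * (count (cl z.1) P)%:R.
  rewrite exchange_big /= mulr_sumr -(pair_bigA _ (fun k i =>
    B * (`|c k i| * (count (cl k) P)%:R))) /=.
  apply: eq_bigr => k _; rewrite exchange_big /=; apply: eq_bigr => i _.
  rewrite count_sum natr_sum !mulr_sumr; apply: eq_bigr => x _.
  by rewrite mulrCA.
rewrite -mulrA ler_wpM2l ?powR_ge0//.
rewrite (bigID A) /= [X in _ + X]big1 ?addr0; last first.
  by move=> z; rewrite -eqn0Ngt => /eqP ->; rewrite mulr0.
apply: (@le_trans _ _ (C%:R * \sum_(z | A z) `|c z.1 z.2|)).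
  rewrite mulr_sumr; apply: ler_sum => z _.
  by rewrite mulrC ler_wpM2r// ler_nat; exact: PC.
by rewrite ler_wpM2l// sum_le_lpnorm// ler_nat.
Qed.

End LevelBound.

(** * Summing over the indices of one level *)

Section TailBound.
Context {R : realType} {s : nat}.
Variables (lam : {measure set (s.-tuple R) -> \bar R}) (b : nat).
Hypotheses (b2 : (2 <= b)%N) (s1 : (1 <= s)%N).
Variables (p q : \bar R) (alpha : R).
Hypothesis q1 : (1 <= q)%E.

Local Notation ex := (alpha - recip p + 2^-1).
Local Notation e := ((s.-1)%:R * (1 - recip q)).

(** On a level the coordinate 0 of j is determined by the other s - 1, each of which takes at most L
    + 1 values. *)
Lemma card_level_le (L : nat) :
  (#|[pred j : {ffun 'I_s -> 'I_L.+1} | (\sum_(l < s) (j l : nat) == L)%N]|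
   <= L.+1 ^ s.-1)%N.
Proof.
case: s s1 => // s' _ /=; set A := [pred _ | _].
pose g (j : {ffun 'I_s'.+1 -> 'I_L.+1}) := [ffun l : 'I_s' => j (lift ord0 l)].
have gi : {in A &, injective g}.
  move=> j j' /eqP; rewrite big_ord_recl => jL /eqP; rewrite big_ord_recl => j'L gj.
  have gl l : j (lift ord0 l) = j' (lift ord0 l).
    by have /ffunP/(_ l) := gj; rewrite !ffunE.
  apply/ffunP => l; have [->|] := eqVneq l ord0.
    apply: val_inj; apply/eqP; rewrite -(eqn_add2r (\sum_(i < s') j (lift ord0 i))).
    by rewrite jL (eq_bigr (fun i => j' (lift ord0 i) : nat)) ?j'L// => i _; rewrite gl.
  by rewrite eq_sym => /unlift_some[l' ->] _.
rewrite -(card_in_image gi); apply: leq_trans (max_card _) _.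
by rewrite card_ffun !card_ord.
Qed.

Variable f : s.-tuple R -> R.
Hypothesis f1 : (wavnorm lam b alpha p q f <= 1)%E.

Local Notation lp j := (lpnorm lam b p f j).

Lemma levelsum_ge0 L (F : ('I_s -> nat) -> R) : (forall j, 0 <= F j) ->
  0 <= levelsum L F.
Proof. by move=> F0; apply: sumr_ge0. Qed.

Lemma wavnorm_fin_partial (r : R) K : q = r%:E ->
  \sum_(0 <= L < K) powR b%:R (r * ex * L%:R)
    * levelsum L (fun j => powR (lp j) r) <= 1.
Proof.
move=> qr; move: f1 q1; rewrite /wavnorm qr lee_fin => h r1.
have r0 : 0 < r by lra.
set u := (X in (\sum_(L <oo) (X L)%:E)%E) in h.
have u0 L : (0 <= (u L)%:E)%E.
  rewrite lee_fin mulr_ge0 ?powR_ge0// levelsum_ge0// => j; exact: powR_ge0.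
rewrite -lee_fin -sumEFin.
apply: (@le_trans _ _ (\sum_(L <oo) (u L)%:E)%E).
  by apply: (@nneseries_lim_ge _ (fun L => (u L)%:E)) => L _ _; exact: u0.
have : (0 <= \sum_(L <oo) (u L)%:E)%E by apply: nneseries_ge0 => L _ _; exact: u0.
(* An infinite series would have an infinite r-th root, and a finite value above 1 would have a root
   above 1. *)
move: h; case: (\sum_(L <oo) (u L)%:E)%E => [x| |] //=; last first.
  by rewrite gt_eqF ?invr_gt0.
rewrite !lee_fin => + x0; apply: contraTT; rewrite -!ltNge => x1.
have := @gt0_ltr_powR _ r^-1 _ 1 x; rewrite powR1 invr_gt0 nnegrE ler01.
by apply; rewrite ?nnegrE.
Qed.

(** Hölder over the indices j of level L, whose share of the norm is at most 1; for q = oo every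
    single term is at most 1. This produces the exponent (s - 1)/q'. *)
Lemma weighted_level_le L :
  powR b%:R (ex * L%:R) * levelsum L (fun j => lp j) <= powR L.+1%:R e.
Proof.
have b0 : 0 < b%:R :> R by rewrite ltr0n ltnW.
have cardL := card_level_le L; rewrite -(@ler_nat R) natrX in cardL.
have powe : powR (L.+1%:R ^+ s.-1) (1 - recip q) = powR L.+1%:R e.
  by rewrite powRrM powR_mulrn.
rewrite -powe.
case qE : q q1 => [r| |]//.
  rewrite lee_fin => r1; have r0 : 0 < r by lra.
  have h : powR b%:R (r * ex * L%:R) * levelsum L (fun j => powR (lp j) r) <= 1.
    apply: le_trans (wavnorm_fin_partial L.+1 qE).
    rewrite big_nat_recr//= lerDr sumr_ge0// => i _.
    by rewrite mulr_ge0 ?powR_ge0// levelsum_ge0// => j; exact: powR_ge0.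
  have := @sum_le_card_powR _ _ _ (fun j : {ffun 'I_s -> 'I_L.+1} =>
    lp (fun l => j l : nat)) _ _ r1 (fun=> lpnorm_ge0 _ _ _ _ _) cardL.
  move=> /(@ler_wpM2l _ _ (powR_ge0 b%:R (ex * L%:R))) /le_trans; apply.
  rewrite mulrCA /= ler_piMr ?powR_ge0//.
  rewrite -/(levelsum L (fun j => powR (lp j) r)).
  rewrite (_ : powR b%:R (ex * L%:R) = powR (powR b%:R (r * ex * L%:R)) r^-1).
    rewrite -powRM ?powR_ge0 ?levelsum_ge0//; last by move=> j; exact: powR_ge0.
    have := @ge0_ler_powR _ r^-1 _ _ 1 _ _ h; rewrite powR1.
    apply; rewrite ?invr_ge0 ?(ltW r0)// nnegrE//.
    by rewrite mulr_ge0 ?powR_ge0// levelsum_ge0// => j; exact: powR_ge0.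
  by rewrite -powRrM mulrAC [r * _]mulrC mulfK// gt_eqF.
move=> _; rewrite subr0 powRr1 ?exprn_ge0//.
apply: le_trans cardL; rewrite -sum1_card natr_sum mulr_sumr.
apply: ler_sum => j /eqP jL; move: f1; rewrite /wavnorm qE.
move=> /(le_trans (ereal_sup_ubound (imageT _ (fun l => j l : nat)))).
by rewrite lee_fin jL.
Qed.

Local Notation d := (alpha - recip p).

(** For q = 1 the norm controls all levels together, so no decay in L is needed and alpha = 1/p is
    admissible. *)
Lemma weighted_level_sum_q1_le K : q = 1%E ->
  \sum_(0 <= L < K) powR b%:R (ex * L%:R) * levelsum L (fun j => lp j) <= 1.
Proof.
move=> qE; apply: le_trans (wavnorm_fin_partial K qE).
apply: ler_sum => L _; rewrite mul1r ler_wpM2l ?powR_ge0//.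
by apply: ler_sum => j _; rewrite powRr1// lpnorm_ge0.
Qed.

Lemma half_powR_levelE L :
  levelsum L (fun j => powR b%:R ((\sum_l j l)%N%:R / 2) * lp j) =
  powR b%:R (- (d * L%:R)) *
    (powR b%:R (ex * L%:R) * levelsum L (fun j => lp j)).
Proof.
have b0 : b%:R != 0 :> R by rewrite pnatr_eq0 -lt0n ltnW.
rewrite mulrA -powRD ?b0 ?implybT// /levelsum mulr_sumr.
apply: eq_bigr => j /eqP ->; congr (powR _ _ * _).
by rewrite mulrDl; field.
Qed.

End TailBound.

(** * Summing over all high levels *)

Section Tail.
Context {R : realType} {s : nat}.
Variables (lam : {measure set (s.-tuple R) -> \bar R}) (b : nat).
Hypotheses (b2 : (2 <= b)%N) (s1 : (1 <= s)%N).
Variables (p q : \bar R) (alpha : R).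
Hypothesis q1 : (1 <= q)%E.
Hypotheses (aq1 : q = 1%E -> recip p <= alpha) (aq : q <> 1%E -> recip p < alpha).

Local Notation d := (alpha - recip p).
Local Notation e := ((s.-1)%:R * (1 - recip q)).

Lemma recip_itv (r : \bar R) : (1 <= r)%E -> 0 <= recip r <= 1.
Proof.
case: r => [r| |]//=; rewrite ?lexx ?ler01// lee_fin => r1.
have r0 : 0 < r by lra.
by rewrite invr_ge0 (ltW r0)/= invf_le1.
Qed.

(** The constant is uniform in f, M and K. For q = 1 the largest factor b^(-dM) is pulled out of a
    sum bounded by 1. For q > 1 the substitution L = M + h separates M from h, and the sum over h is
    bounded since d > 0. *)
Lemma tail_bound : exists2 C : R, 0 <= C &
  forall f, (wavnorm lam b alpha p q f <= 1)%E -> forall M K,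
  \sum_(M <= L < K) levelsum L (fun j =>
      powR b%:R ((\sum_l j l)%N%:R / 2) * lpnorm lam b p f j)
    <= C * powR b%:R (- (d * M%:R)) * powR M.+1%:R e.
Proof.
have b0 : 0 < b%:R :> R by rewrite ltr0n ltnW.
have b1 : 1 < b%:R :> R by rewrite ltr1n.
have [qE|/eqP qn1] := eqVneq q 1%E.
  exists 1 => // f f1 M K.
  have d0 : 0 <= d by rewrite subr_ge0 aq1.
  rewrite (_ : e = 0) ?powRr0; last by rewrite qE /= invr1 subrr mulr0.
  rewrite mul1r mulr1.
  have [KM|MK] := leqP K M; first by rewrite big_geq ?powR_ge0.
  apply: (@le_trans _ _ (\sum_(M <= L < K) powR b%:R (- (d * M%:R)) *
     (powR b%:R ((d + 2^-1) * L%:R) * levelsum L (fun j => lpnorm lam b p f j)))).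
    rewrite big_nat [leRHS]big_nat; apply: ler_sum => L /andP[ML _].
    rewrite (half_powR_levelE _ b2 _ alpha) ler_wpM2r//.
      by rewrite mulr_ge0 ?powR_ge0// levelsum_ge0// => j; exact: lpnorm_ge0.
    by rewrite ler_powR ?(ltW b1)// lerN2 ler_wpM2l// ler_nat.
  rewrite -mulr_sumr ler_piMr ?powR_ge0//.
  apply: le_trans (weighted_level_sum_q1_le q1 f1 K qE).
  rewrite [leRHS](@big_cat_nat _ _ _ M)//= 1?ltnW// lerDr sumr_ge0// => L _.
  by rewrite mulr_ge0 ?powR_ge0// levelsum_ge0// => j; exact: lpnorm_ge0.
have d0 : 0 < d by rewrite subr_gt0 aq.
have lnb : 0 < ln (b%:R : R) by rewrite ln_gt0.
have [C C0 CK] := sum_poly_expR_bounded s.-1 (mulr_gt0 d0 lnb).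
have /andP[rq0 rq1] := recip_itv q1.
have e0 : 0 <= e by rewrite mulr_ge0// subr_ge0.
(* This lets (h + 1)^e be replaced by an integer power, to which [sum_poly_expR_bounded] applies. *)
have es : e <= s.-1%:R by rewrite ler_piMr// gerBl.
exists C => // f f1 M K.
have [KM|MK] := leqP K M.
  by rewrite big_geq// !mulr_ge0 ?powR_ge0.
rewrite -{1}(add0n M) big_addn big_mkord.
apply: (@le_trans _ _ (\sum_(h < K - M) powR b%:R (- (d * M%:R)) * powR M.+1%:R e *
   (expR (- (d * ln b%:R * h%:R)) * h.+1%:R ^+ s.-1))); last first.
  by rewrite -mulr_sumr mulrC -mulrA ler_wpM2r// mulr_ge0 ?powR_ge0.
apply: ler_sum => h _; rewrite (half_powR_levelE _ b2 _ alpha).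
have := weighted_level_le b2 s1 q1 f1 (h + M).
move=> /(@ler_wpM2l _ _ (powR_ge0 b%:R (- (d * (h + M)%:R)))) /le_trans; apply.
rewrite (_ : - (d * (h + M)%:R) = - (d * M%:R) + - (d * h%:R)); last first.
  by rewrite natrD; ring.
rewrite powRD; last by rewrite (gt_eqF b0) implybT.
rewrite -!mulrA ler_wpM2l ?powR_ge0//.
rewrite (_ : powR b%:R (- (d * h%:R)) = expR (- (d * (ln b%:R * h%:R)))); last first.
  by rewrite /powR gt_eqF//; congr expR; ring.
rewrite [leRHS]mulrCA ler_wpM2l ?expR_ge0//.
(* The bound h + M + 1 <= (M + 1)(h + 1) splits the polynomial factor. *)
apply: (@le_trans _ _ (powR (M.+1%:R * h.+1%:R) e)).
  apply: ge0_ler_powR => //; rewrite ?nnegrE// -natrM ler_nat.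
  by clear; rewrite mulSn mulnS; lia.
rewrite powRM// ler_wpM2l ?powR_ge0// -powR_mulrn//.
by rewrite ler_powR// ler1n.
Qed.

End Tail.

(** * Auxiliary facts on series and finite sums *)

Section Series.
Context {R : realType}.

Lemma series_cvg_of_bounded (u v : R^nat) (C : R) :
  (forall n, `|u n| <= v n) -> (forall n, \sum_(0 <= k < n) v k <= C) ->
  cvgn (series u).
Proof.
move=> uv vC; apply: normed_cvg; apply: nondecreasing_is_cvgn.
  apply/nondecreasing_seqP => n.
  by rewrite -subr_ge0 seriesSB normr_ge0.
exists C => _ [n _ <-]; apply: le_trans (vC n).
by apply: ler_sum => k _; exact: uv.
Qed.

Lemma cvg_sum_seq (T : eqType) (P : seq T) (g : T -> R^nat) (a : T -> R) :
  (forall x, x \in P -> g x @ \oo --> a x) ->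
  (fun n => \sum_(x <- P) g x n) @ \oo --> \sum_(x <- P) a x.
Proof.
elim: P => [|x P IH] ga.
  under eq_fun do rewrite big_nil.
  by rewrite big_nil; exact: cvg_cst.
under eq_fun do rewrite big_cons.
rewrite big_cons; apply: cvgD; first by apply: ga; rewrite mem_head.
by apply: IH => y yP; apply: ga; rewrite inE yP orbT.
Qed.

Lemma sum_dffun_ord1 (s : nat) (n : 'I_s -> nat)
    (F : {dffun forall l : 'I_s, 'I_(n l)} -> R) (v : R) :
  (forall l, n l = 1%N) -> (forall k, F k = v) -> \sum_k F k = v.
Proof.
move=> n1 Fv; rewrite (eq_bigr (fun=> v))// sumr_const.
rewrite card_dep_ffun foldrE big_map big_enum /= big1// => l _.
by rewrite card_ord n1.
Qed.

End Series.

(** * The cubature error of one function *)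

Section Error.
Context {R : realType} {s : nat}.
Variables (lam : {measure set (s.-tuple R) -> \bar R}) (b : nat).
Hypotheses (b2 : (2 <= b)%N).
Variables (p : \bar R) (f : s.-tuple R -> R).
Hypothesis p1 : (1 <= p)%E.

Let b0 : (0 < b)%N. Proof. exact: ltnW. Qed.

Local Notation S L := (levelsum L (fun j =>
  powR b%:R ((\sum_l j l)%N%:R / 2) * lpnorm lam b p f j)).

Lemma sum_wavlevel_bound (P : seq (s.-tuple R)) (C L : nat) :
  (forall x, x \in P -> forall l, 0 <= tnth x l) ->
  (forall j k : 'I_s -> nat, (\sum_l j l)%N = L -> (forall l, k l < b ^ (j l - 1))%N ->
     count (in_cell b (fun l => j l - 1)%N k) P <= C)%N ->
  \sum_(x <- P) `|wavlevel lam b f L x|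
    <= C%:R * powR (size P * b ^ s)%N%:R (1 - recip p) * S L.
Proof.
move=> P0 PC; rewrite /wavlevel /levelsum.
apply: le_trans (ler_sum _ (fun x _ => ler_norm_sum _ _ _)) _.
rewrite exchange_big /= mulr_sumr; apply: ler_sum => j /eqP jL.
apply: le_trans (sum_level_bound lam b0 f p1 P0 (C := C) _) _.
  by move=> k; apply: PC => // l; exact: ltn_ord.
by rewrite le_eqVlt; apply/orP; left; apply/eqP; ring.
Qed.

(** The level bound for the one-point set [[:: x]], with C = 1, dominates the series; this justifies
    point evaluation for finite q, where [in_Hwav] does not demand convergence. *)
Lemma wavlevel_cvg (C0 : R) (x : s.-tuple R) :
  (forall l, 0 <= tnth x l) -> (forall K, \sum_(0 <= L < K) S L <= C0) ->
  cvgn (series (fun L => wavlevel lam b f L x)).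
Proof.
move=> x0 SC; pose c : R := powR (1 * b ^ s)%N%:R (1 - recip p).
apply: (@series_cvg_of_bounded _ _ (fun L => c * S L) (c * C0)) => [L|K].
  have := @sum_wavlevel_bound [:: x] 1 L; rewrite big_seq1 mul1r; apply.
    by move=> y; rewrite inE => /eqP ->.
  by move=> j k _ _ /=; rewrite addn0 leq_b1.
by rewrite -mulr_sumr ler_wpM2l// powR_ge0.
Qed.

Variables (l0 : 'I_s) (t m : nat) (P : seq (s.-tuple R)).
Hypothesis netP : is_net b t m P.

Lemma net_wavlevel_sum0 L : (0 < L <= m - t)%N ->
  \sum_(x <- P) wavlevel lam b f L x = 0.
Proof.
move=> Lmt; rewrite /wavlevel /levelsum exchange_big /= big1// => j /eqP jL.
rewrite exchange_big /= big1// => k _; rewrite exchange_big /= big1// => i _.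
rewrite -mulr_sumr (net_haar_sum b0 netP l0) ?mulr0// ?jL// => l; exact: ltn_ord.
Qed.

Hypothesis lamE : forall a c : s.-tuple R, (forall l, tnth a l <= tnth c l) ->
  lam [set x | forall l, tnth a l <= tnth x l < tnth c l]
  = (\prod_(l < s) (tnth c l - tnth a l))%:E.
Hypothesis fint : lam.-integrable (@cube R s) (EFin \o f).

(** Level 0 has a single triple (j, k, i). The coordinates must be below 1 because the level-0 Haar
    function is 0 on the upper faces. *)
Lemma wavlevel0 x : (forall l, 0 <= tnth x l < 1) ->
  wavlevel lam b f 0 x = \int[lam]_(x in @cube R s) f x.
Proof.
move=> x01; rewrite /wavlevel /levelsum.
have j0 (j : {ffun 'I_s -> 'I_1}) l : (j l : nat) = 0%N by case: (j l) => -[].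
rewrite (bigD1 [ffun=> ord0]) /=; last by rewrite big1// => l _; rewrite ffunE.
rewrite [X in _ + X]big1 ?addr0; last first.
  move=> j /andP[_ /eqP[]]; apply/ffunP => l; apply: val_inj.
  by rewrite /= !j0.
set j := [ffun=> ord0].
apply: sum_dffun_ord1 => [l|k]; first by rewrite j0 expn0.
apply: sum_dffun_ord1 => [l|i]; first by rewrite j0.
by rewrite (coef_level0 lamE)// haar_level0// indicE mem_set ?mulr1.
Qed.

(** Truncating at level K keeps all sums finite: level 0 cancels the integral, levels 1 to m - t
    cancel over the net, and only the higher levels remain. *)
Lemma net_error_partial K : (m - t < K)%N ->
  `|\int[lam]_(x in @cube R s) f x
    - b%:R ^- m * \sum_(x <- P) series (fun L => wavlevel lam b f L x) K|
  <= b%:R ^- m * (b ^ (t + s))%N%:R * powR (b ^ m * b ^ s)%N%:R (1 - recip p)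
     * \sum_((m - t).+1 <= L < K) S L.
Proof.
move=> mtK; set I := \int[lam]_(x in _) _.
have Psize := net_size b0 netP l0.
have bm : 0 < b%:R ^+ m :> R by rewrite exprn_gt0// ltr0n.
have x01 x : x \in P -> forall l, 0 <= tnth x l < 1 by case: netP => _ _ h _; exact: h.
have -> : \sum_(x <- P) series (fun L => wavlevel lam b f L x) K =
    b%:R ^+ m * I + \sum_((m - t).+1 <= L < K) \sum_(x <- P) wavlevel lam b f L x.
  rewrite /series/= exchange_big /= (@big_cat_nat _ _ _ (m - t).+1)//=.
  congr (_ + _); rewrite big_ltn// big_nat [X in _ + X]big1 ?addr0; last first.
    by move=> L /andP[L1 L2]; apply: net_wavlevel_sum0; rewrite L1.
  rewrite big_seq (eq_bigr (fun=> I)); last by move=> x /x01; exact: wavlevel0.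
  by rewrite -big_seq big_const_seq count_predT iter_addr addr0 Psize -natrX mulr_natl.
rewrite mulrDr mulKf ?gt_eqF// opprD addrA subrr sub0r normrN normrM.
rewrite ger0_norm ?invr_ge0 ?(ltW bm)// -!mulrA ler_wpM2l ?invr_ge0 ?(ltW bm)//.
apply: le_trans (ler_norm_sum _ _ _) _; rewrite mulrA mulr_sumr.
rewrite big_nat [leRHS]big_nat; apply: ler_sum => L /andP[mtL _].
apply: le_trans (ler_norm_sum _ _ _) _.
rewrite -Psize; apply: sum_wavlevel_bound; first exact: net_ge0 netP.
move=> j k jL kb; apply: (net_count_support b0 netP l0) => //.
by rewrite jL.
Qed.

(** The truncated bound passes to the limit in K, since P is finite and the series converges at each
    of its points. *)
Lemma net_error_bound (B : R) :
  (forall x, x \in P -> cvgn (series (fun L => wavlevel lam b f L x))) ->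
  (forall K, \sum_((m - t).+1 <= L < K) S L <= B) ->
  `|\int[lam]_(x in @cube R s) f x - QMC lam b m P f|
  <= b%:R ^- m * (b ^ (t + s))%N%:R * powR (b ^ m * b ^ s)%N%:R (1 - recip p) * B.
Proof.
move=> fcvg SB; rewrite /QMC.
have cvgP : (fun n => \sum_(x <- P) series (fun L => wavlevel lam b f L x) n) @ \oo
    --> \sum_(x <- P) wavseries lam b f x.
  by apply: cvg_sum_seq => x /fcvg.
have cvgE : (fun n => `|\int[lam]_(x in @cube R s) f x - b%:R ^- m *
      \sum_(x <- P) series (fun L => wavlevel lam b f L x) n|) @ \oo -->
    `|\int[lam]_(x in @cube R s) f x - b%:R ^- m * \sum_(x <- P) wavseries lam b f x|.
  by apply: cvg_norm; apply: cvgB; [exact: cvg_cst|apply: cvgM => //; exact: cvg_cst].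
apply: (cvgr_to_le cvgE).
near=> K; apply: le_trans (net_error_partial _) _.
  by near: K; exists (m - t).+1.
by rewrite ler_wpM2l.
Unshelve. all: by end_near.
Qed.

End Error.

(** * Assembling the worst-case error bound *)

Theorem theorem2 (R : realType) (b s t : nat) (p q : \bar R) (alpha : R)
  (lam : {measure set (s.-tuple R) -> \bar R}) :
  (2 <= b)%N -> (1 <= s)%N ->
  (1 <= p)%E -> (1 <= q)%E ->
  (q = 1%E -> recip p <= alpha) ->
  (q <> 1%E -> recip p < alpha) ->
  (* lam is the s-dimensional Lebesgue measure on (Borel sets of) R^s *)
  (forall a c : s.-tuple R, (forall l, tnth a l <= tnth c l) ->
     lam [set x | forall l, tnth a l <= tnth x l < tnth c l]
     = (\prod_(l < s) (tnth c l - tnth a l))%:E) ->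
  exists C : R, forall (m : nat) (P : seq (s.-tuple R)),
    (1 <= m)%N -> is_net b t m P ->
    (wce lam b alpha p q m P
     <= (C * powR (b%:R ^+ m) (- alpha)
           * powR (ln (b%:R ^+ m)) ((s.-1)%:R * (1 - recip q)))%:E)%E.
Proof.
move=> b2 s1 p1 q1 aq1 aq lamE.
have [C0 C00 tail] := tail_bound lam b2 s1 q1 aq1 aq.
have B0 : 0 < b%:R :> R by rewrite ltr0n ltnW.
have lnb : 0 < ln (b%:R : R) by rewrite ln_gt0// ltr1n.
have /andP[rq0 rq1] := recip_itv q1.
(* This is (s - 1)/q'; for q = 1 it is 0 and the logarithmic factor is 1. *)
set e := s.-1%:R * _ in tail *.
have e0 : 0 <= e by rewrite mulr_ge0// subr_ge0.
pose rho := recip p; pose d := alpha - rho.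
(* The exponent of b collects t + s from the points per support, s(1 - 1/p) from the number of pairs
   seen, and d(t - 1) from b^(-d(m - t + 1)). The last factor turns 3m into 3 ln N / ln b. *)
exists (C0 * powR b%:R (t%:R + s%:R + s%:R * (1 - rho) + d * (t%:R - 1))
        * powR (3 / ln b%:R) e) => m P m1 netP.
have tm : (t <= m)%N by case: netP.
apply: ge_ereal_sup => _ [f [[fint _ _] f1] <-]; rewrite lee_fin.
have fcvg x : x \in P -> cvgn (series (fun L => wavlevel lam b f L x)).
  by move=> xP; apply: (wavlevel_cvg b2 p1 _ (tail f f1 0%N)); exact: (net_ge0 netP).
apply: le_trans (net_error_bound b2 p1 (Ordinal s1) netP lamE fint fcvg
  (tail f f1 (m - t).+1)) _.
(* Since m >= 1, m - t + 2 <= 3m, and m ln b = ln N. *)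
have me : powR (m - t).+2%:R e
    <= powR (3 / ln b%:R) e * powR (ln (b%:R ^+ m)) e.
  have ln3 : 3 / ln b%:R * ln (b%:R ^+ m) = (3 * m)%N%:R :> R.
    by rewrite lnXn// -[_ *+ m]mulr_natl mulrCA divfK ?gt_eqF// natrM mulrC.
  rewrite -powRM ?ln3; last 2 first.
  - by rewrite divr_ge0// ltW.
  - by rewrite ln_ge0// exprn_ege1// ler1n ltnW.
  by apply: ge0_ler_powR; rewrite ?nnegrE// ler_nat; clear -tm m1; lia.
(* The powers of b depending on m combine to -m + m(1 - 1/p) - m(alpha - 1/p) = -alpha m. *)
have bE : b%:R ^- m * (b ^ (t + s))%N%:R * powR (b ^ m * b ^ s)%N%:R (1 - recip p)
     * powR b%:R (- ((alpha - recip p) * (m - t).+1%:R)) =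
   powR b%:R (t%:R + s%:R + s%:R * (1 - rho) + d * (t%:R - 1))
     * powR (b%:R ^+ m) (- alpha).
  have bn0 : b%:R != 0 :> R by rewrite gt_eqF.
  rewrite -expnD !natrX -powR_invn ?(ltW B0)// -!powR_mulrn ?(ltW B0)//.
  rewrite -!powRrM -!powRD ?bn0 ?implybT//; congr powR.
  by rewrite -natr1 natrB// /d /rho !natrD; ring.
rewrite [leLHS](_ : _ = C0 * (powR b%:R (t%:R + s%:R + s%:R * (1 - rho)
    + d * (t%:R - 1)) * powR (b%:R ^+ m) (- alpha)) * powR (m - t).+2%:R e).
  rewrite [leRHS](_ : _ = C0 * (powR b%:R (t%:R + s%:R + s%:R * (1 - rho)
    + d * (t%:R - 1)) * powR (b%:R ^+ m) (- alpha)) *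
    (powR (3 / ln b%:R) e * powR (ln (b%:R ^+ m)) e)); last by ring.
  by rewrite ler_wpM2l// !mulr_ge0 ?powR_ge0.
by rewrite -bE; ring.
Qed.
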